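(* Let $g\in \mathcal{C}^{2}_{+}((1,\infty))$. Then: (i) for every fixed real number $\alpha\neq 0$, for (Lebesgue) almost all real numbers $\beta>1$ and for all real polynomials $Q\in\mathbb{R}[x]$, the sequence $$\big(\alpha\beta^{n}g(\beta)+Q(n)\big)_{n\in\mathbb{N}}$$ is uniformly distributed modulo $1$; (ii) alternatively, for every fixed real number $\beta>1$, for (Lebesgue) almost all real numbers $\alpha$ and for all real polynomials $Q\in\mathbb{R}[x]$, the same sequence is uniformly distributed modulo $1$. (In both cases the exceptional null set does not depend on $Q$.)
   Context: $\mathbb{N}$ denotes the set of positive integers. For an interval $I\subset\mathbb{R}$ and an integer $k\ge 0$, $\mathcal{C}^{k}_{+}(I)$ is the space of all positive real-valued, $k$-times continuously differentiable functions on $I$ whose $i$-th derivative is non-negative on $I$ for all $i\le k$. $\mathbb{R}[x]$ is the set of all real polynomials. For real $x$, $\{x\}=x-[x]$ is the fractional part, where $[x]$ is the greatest integer $\le x$. A sequence $(x_n)_{n\in\mathbb{N}}$ of real numbers is uniformly distributed modulo $1$ if for all $0\le a<b\le 1$, $\lim_{N\to\infty}\frac{1}{N}\#\{n\in[1,N] : \{x_n\}\in[a,b]\}=b-a$. *)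

(* Defs.v *)
From HB Require Import structures.
From mathcomp Require Import all_boot all_order all_algebra.
From mathcomp Require Import all_classical all_reals all_analysis.

Set Implicit Arguments.
Unset Strict Implicit.
Unset Printing Implicit Defensive.

Import Order.TTheory GRing.Theory Num.Theory.
Import numFieldNormedType.Exports.

Local Open Scope classical_set_scope.
Local Open Scope ring_scope.

(* The class C^k_+(I), for I an OPEN interval: derivatives at points of I are
   then local to I, so the values of the total function f outside I are
   irrelevant. (For a non-open I one would need one-sided derivatives.) *)
Definition Cplus (R : realType) (k : nat) (I : set R) (f : R -> R) : Prop :=
  [/\ forall x, I x -> 0 < f x,
      forall i, (i < k)%N -> forall x, I x -> derivable (derive1n i f) x 1,
      forall i, (i <= k)%N -> {within I, continuous (derive1n i f)} &
      forall i, (i <= k)%N -> forall x, I x -> 0 <= derive1n i f x].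

Definition frac_part (R : realType) (x : R) : R := x - (Num.floor x)%:~R.

(* A sequence (x_n) indexed by the positive integers is given as a function on
   nat whose value at 0 is never used. *)
Definition count_frac (R : realType) (x : nat -> R) (a b : R) (N : nat) : nat :=
  count (fun n => frac_part (x n) \in `[a, b]) (iota 1 N).

Definition unif_distributed_mod1 (R : realType) (x : nat -> R) : Prop :=
  forall a b : R, 0 <= a -> a < b -> b <= 1 ->
    (count_frac x a b N)%:R / N%:R @[N --> \oo] --> b - a.

(* Main.v *)
(* The exceptional null set can be chosen independently of [Q] because van der
   Corput's difference theorem removes [Q] altogether: differencing
   [alpha b^n g(b) + Q(n)] with lags [h_1, ..., h_d], where [d] is the degree
   of [Q], leaves [alpha b^n g(b) (b^(h_1) - 1) ... (b^(h_d) - 1)] plus a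
   constant, and there are only countably many tuples of lags. Multiplying [g]
   by the factors [b^h - 1] keeps it in C^2_+, so it remains to prove Koksma's
   metric theorem: for almost all [b] the averages of
   [cos (2 pi k alpha b^n G(b) + t)] tend to 0. For [m < n], the phase
   difference [f_n - f_m] has a nondecreasing derivative bounded below by a
   multiple of [n], so the first derivative test gives
   [int |sum_(n < N) exp (i f_n)|^2 = O(N)] on every segment of [(1, oo)]; the
   averages therefore vanish almost everywhere along [N = j^2], hence along all
   [N]. All exponential sums are kept real by allowing an arbitrary phase [t]
   in the cosines. Weyl's criterion is obtained by discretizing the
   convolution with the Fejer kernel: the functions [fejer n (x - j / n)],
   [j < n], form a partition of unity by trigonometric polynomials of mean
   [1 / n]. *)

Require Import Defs.
From mathcomp Require Import all_boot all_order all_algebra.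
From mathcomp Require Import all_classical all_reals all_analysis.
From mathcomp Require Import ring lra zify.
Import Order.TTheory GRing.Theory Num.Theory.
Import numFieldNormedType.Exports.
Local Open Scope classical_set_scope.
Local Open Scope ring_scope.
Set Implicit Arguments.
Unset Strict Implicit.
Unset Printing Implicit Defensive.

(** * Averages and van der Corput's difference theorem *)

Section Averages.
Context {R : realType}.
Implicit Types (c d y : nat -> R) (N h : nat).

Definition avg c N : R := (\sum_(n < N) c n) / N%:R.

Lemma eq_avg c d : c =1 d -> avg c = avg d.
Proof. by move=> cd; apply/funext => N; rewrite /avg; under eq_bigr do rewrite cd. Qed.

Lemma avgD c d N : avg (fun n => c n + d n) N = avg c N + avg d N.
Proof. by rewrite /avg big_split/= mulrDl. Qed.

Lemma avgZ k c N : avg (fun n => k * c n) N = k * avg c N.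
Proof. by rewrite /avg -mulr_sumr mulrA. Qed.

Lemma avg_sum (I : Type) (s : seq I) (c : I -> nat -> R) N :
  avg (fun n => \sum_(i <- s) c i n) N = \sum_(i <- s) avg (c i) N.
Proof. by rewrite /avg exchange_big/= mulr_suml. Qed.

Lemma ler_avg c d N : (forall n, c n <= d n) -> avg c N <= avg d N.
Proof.
by move=> cd; rewrite /avg ler_wpM2r ?invr_ge0// ler_sum.
Qed.

(** The gap between the two sides is the variance of the first [N] values. *)
Lemma avg_sqr_le c N : avg c N ^+ 2 <= avg (fun n => c n ^+ 2) N.
Proof.
case: N => [|N]; first by rewrite /avg !big_ord0 !mul0r expr0n.
set m := avg c N.+1.
have N0 : N.+1%:R != 0 :> R by rewrite pnatr_eq0.
have sumE : \sum_(n < N.+1) c n = m * N.+1%:R by rewrite /m /avg divfK.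
have : 0 <= \sum_(n < N.+1) (c n - m) ^+ 2 by apply: sumr_ge0 => i _; exact: sqr_ge0.
have -> : \sum_(n < N.+1) (c n - m) ^+ 2 =
    \sum_(n < N.+1) c n ^+ 2 - (m ^+ 2) * N.+1%:R.
  transitivity (\sum_(n < N.+1) (c n ^+ 2 + (- 2 * m) * c n + m ^+ 2)).
    by apply: eq_bigr => i _; ring.
  rewrite !big_split/= -mulr_sumr sumE sumr_const card_ord -[X in _ + X]mulr_natr.
  ring.
by rewrite subr_ge0 => h; rewrite /avg ler_pdivlMr// ltr0n.
Qed.

Lemma cvg_sumr (I : Type) (s : seq I) (F : I -> nat -> R) (l : I -> R) :
  (forall i, F i n @[n --> \oo] --> l i) ->
  (\sum_(i <- s) F i n) @[n --> \oo] --> \sum_(i <- s) l i.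
Proof. by move=> Fl; apply: cvg_big => //; exact: add_continuous. Qed.

Lemma cvg_bounded_divn (u : nat -> R) B : (forall n, `|u n| <= B) ->
  u n / n%:R @[n --> \oo] --> 0.
Proof.
move=> uB; apply/cvgrPdist_le => e e0.
near=> n.
rewrite sub0r normrN normrM normfV normr_nat.
have n0 : (0 < n)%N by near: n; exists 1%N.
rewrite ler_pdivrMr ?ltr0n//.
apply: (le_trans (uB _)); rewrite mulrC -ler_pdivrMr//.
near: n; exact: nbhs_infty_ger.
Unshelve. all: by end_near. Qed.

(** Each unit shift trades one boundary term for another, at a cost of at most [2B / N]. *)
Lemma cvg_avg_shift c B h : (forall n, `|c n| <= B) ->
  avg (fun n => c (n + h)%N) N - avg c N @[N --> \oo] --> 0.
Proof.
move=> cB; elim: h => [|h ih].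
  apply: cvg_near_cst; apply: nearW => N.
  by rewrite (@eq_avg (fun n => c (n + 0)%N) c) ?subrr// => n; rewrite addn0.
rewrite [X in X @ _](_ : _ = (fun N => (c (N + h)%N - c h) / N%:R +
   (avg (fun n => c (n + h)%N) N - avg c N))).
  rewrite -[X in _ --> X]addr0; apply: cvgD ih.
  apply: (@cvg_bounded_divn _ (B + B)) => n.
  by rewrite (le_trans (ler_normB _ _))// lerD.
apply/funext => N; rewrite addrA; congr (_ - _).
rewrite /avg -mulrDl; congr (_ / _).
apply: (@addrI _ (c h)); rewrite addrA addrCA subrr addr0.
transitivity (\sum_(n < N.+1) c (n + h)%N); last by rewrite big_ord_recr/= addrC.
rewrite big_ord_recl/= add0n; congr (_ + _); apply: eq_bigr => i _.
by rewrite /bump/= add1n addSnnS.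
Qed.

(** Averaging over windows of length [H] does not change the limit, and Cauchy-Schwarz bounds the
    square of the mean by the mean correlation within a window. Off-diagonal correlations vanish in
    the limit, which leaves [1 / H] with [H] arbitrary. *)
Lemma van_der_corput y :
  (forall h, (0 < h)%N -> avg (fun n => cos (y (n + h)%N - y n)) N @[N --> \oo] --> 0) ->
  avg (fun n => cos (y n)) N @[N --> \oo] --> 0.
Proof.
move=> yh.
have cosB1 (z : nat -> R) n : `|cos (z n)| <= 1 by exact: cos_max.
have key H : (0 < H)%N ->
    \forall N \near \oo, avg (fun n => cos (y n)) N ^+ 2 <= 4 / H%:R.
  move=> H0.
  have HR0 : (0 : R) < H%:R by rewrite ltr0n.
  (* [W n] is the squared modulus of the window mean of [exp (i y)], and [V n] is the real part of
     that mean. *)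
  pose V n := H%:R^-1 * \sum_(h <- iota 0 H) cos (y (n + h)%N).
  pose W n := H%:R^-2 * \sum_(h <- iota 0 H) \sum_(l <- iota 0 H)
     cos (y (n + h)%N - y (n + l)%N).
  have VW n : V n ^+ 2 <= W n.
    rewrite /V /W exprMn exprVn ler_wpM2l ?invr_ge0 ?sqr_ge0//.
    set C := \sum_(h <- _) cos _; set S := \sum_(h <- iota 0 H) sin (y (n + h)%N).
    suff -> : \sum_(h <- iota 0 H) \sum_(l <- iota 0 H) cos (y (n + h)%N - y (n + l)%N) =
        C ^+ 2 + S ^+ 2 by rewrite lerDl sqr_ge0.
    rewrite !expr2 {1}/C {1}/S !mulr_suml -big_split/=; apply: eq_bigr => h _.
    rewrite /C /S !mulr_sumr -big_split/=; apply: eq_bigr => l _.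
    by rewrite cosB.
  have cV : avg V N - avg (fun n => cos (y n)) N @[N --> \oo] --> 0.
    rewrite [X in X @ _](_ : _ = (fun N => H%:R^-1 * \sum_(h <- iota 0 H)
       (avg (fun n => cos (y (n + h)%N)) N - avg (fun n => cos (y n)) N))).
      rewrite -[X in _ --> X](mulr0 H%:R^-1); apply: cvgMr.
      have := cvg_sumr (s := iota 0 H) (fun h => @cvg_avg_shift (fun n => cos (y n)) 1 h (cosB1 y)).
      by rewrite big1_eq.
    apply/funext => N; rewrite avgZ avg_sum big_split/= mulrDr; congr (_ + _).
    rewrite big_const_seq count_predT size_iota iter_addr_0 -[X in _ = _ * X]mulr_natr.
    by rewrite mulrCA mulVf ?mulr1// gt_eqF.
  have pairs h l : avg (fun n => cos (y (n + h)%N - y (n + l)%N)) N @[N --> \oo]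
      --> ((h == l)%:R : R).
    wlog : h l / (l <= h)%N.
      move=> wl; case: (leqP l h) => [/wl//|/ltnW/wl].
      rewrite eq_sym; rewrite (@eq_avg _ (fun n => cos (y (n + h)%N - y (n + l)%N)))//.
      by move=> n; rewrite -cosN opprB.
    rewrite leq_eqVlt => /predU1P[->|lh].
      rewrite eqxx; apply: cvg_near_cst.
      near=> N; rewrite /avg (eq_bigr (fun=> 1)) ?sumr_const ?card_ord ?divff//=.
        rewrite pnatr_eq0 -lt0n; near: N; by exists 1%N.
      by move=> i _; rewrite subrr cos0.
    rewrite (gtn_eqF lh)/=.
    have := yh (h - l)%N; rewrite subn_gt0 => /(_ lh) c1.
    have c2 := @cvg_avg_shift (fun n => cos (y (n + (h - l))%N - y n)) 1 l (fun n => cos_max _).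
    have -> : avg (fun n => cos (y (n + h)%N - y (n + l)%N)) = (fun N =>
        avg (fun n => cos (y (n + l + (h - l))%N - y (n + l)%N)) N -
        avg (fun n => cos (y (n + (h - l))%N - y n)) N +
        avg (fun n => cos (y (n + (h - l))%N - y n)) N).
      apply/funext => N; rewrite subrK; congr (avg _ _).
      by apply/funext => n; rewrite -addnA (addnC l) subnK// ltnW.
    by rewrite -[X in _ --> X]addr0; exact: cvgD.
  have cW : avg W N @[N --> \oo] --> (H%:R^-1 : R).
    rewrite (_ : avg W = (fun N => H%:R^-2 * \sum_(h <- iota 0 H) \sum_(l <- iota 0 H)
       avg (fun n => cos (y (n + h)%N - y (n + l)%N)) N)); last first.
      apply/funext => N; rewrite avgZ avg_sum; congr (_ * _).
      by apply: eq_bigr => h _; rewrite avg_sum.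
    have -> : H%:R^-1 = H%:R^-2 * \sum_(h <- iota 0 H) \sum_(l <- iota 0 H) (h == l)%:R :> R.
      rewrite (eq_big_seq (fun=> 1)).
        rewrite big_const_seq count_predT size_iota iter_addr_0.
        by field; rewrite gt_eqF.
      move=> h hH; rewrite (big_rem h)//= eqxx big1_seq ?addr0// => l /=.
      by rewrite mem_rem_uniq ?iota_uniq// inE => /andP[/negbTE]; rewrite eq_sym => ->.
    apply: cvgMr; by apply: cvg_sumr => h; apply: cvg_sumr => l; exact: pairs.
  near=> N.
  have a1 : `|avg V N - avg (fun n => cos (y n)) N| <= Num.sqrt (H%:R^-1 / 2).
    rewrite -[X in `|X|]opprK normrN -[X in `|X|]sub0r; near: N.
    have /cvgrPdist_le := cV; apply.
    by rewrite sqrtr_gt0 divr_gt0// invr_gt0.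
  have a2 : avg W N <= H%:R^-1 + H%:R^-1 / 2.
    rewrite -lerBlDl; apply: (le_trans (ler_norm _)); rewrite distrC; near: N.
    have /cvgrPdist_le := cW; apply.
    by rewrite divr_gt0// invr_gt0.
  have a3 : avg V N ^+ 2 <= avg W N.
    by apply: (le_trans (avg_sqr_le _ _)); exact: ler_avg.
  have a4 : (avg V N - avg (fun n => cos (y n)) N) ^+ 2 <= H%:R^-1 / 2.
    rewrite -real_normK ?num_real// -[leRHS]sqr_sqrtr; last by rewrite divr_ge0// invr_ge0.
    by rewrite ler_sqr// nnegrE.
  move: a2 a3 a4; move: (avg V N) (avg W N) (avg _ N) (H%:R^-1) => v w a i a2 a3 a4.
  (* Here [a^2 = 2 v^2 + 2 (v - a)^2 - (v + (v - a))^2 <= 3 i + i], the source of the constant 4. *)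
  have := sqr_ge0 (v + (v - a)).
  by have : v ^+ 2 <= i + i / 2 by [exact: le_trans a3 a2]; nra.
apply/cvgrPdist_le => e e0.
pose H := (Num.truncn (4 / e ^+ 2)).+1.
have He : 4 / H%:R <= e ^+ 2.
  rewrite ler_pdivrMr ?ltr0n// mulrC -ler_pdivrMr ?exprn_gt0//.
  by apply/ltW; rewrite truncnS_gt.
have := key H isT; apply: filterS => N hN.
rewrite sub0r normrN -ler_sqr ?nnegrE// ?(ltW e0)//.
by rewrite real_normK ?num_real//; exact: le_trans He.
Unshelve. all: by end_near. Qed.

End Averages.

(** * Removal of the polynomial by repeated differencing *)

Section Differencing.
Context {R : realType}.
Implicit Types (Q : {poly R}).

(** A translation preserves the degree and the leading coefficient, so the top terms cancel. *)
Lemma size_poly_diff Q (a : R) : (size (Q \Po ('X + a%:P) - Q)%R <= (size Q).-1)%N.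
Proof.
have s2 : size ('X + a%:P) = 2%N by rewrite size_XaddC.
have sQ : size (Q \Po ('X + a%:P)) = size Q by rewrite size_comp_poly2.
have lQ : lead_coef (Q \Po ('X + a%:P)) = lead_coef Q.
  by rewrite lead_coef_comp ?s2// lead_coefXaddC expr1n mulr1.
apply/leq_sizeP => j; rewrite coefB leq_eqVlt => /predU1P[<-|jQ].
  by move: lQ; rewrite /lead_coef sQ => ->; rewrite subrr.
have {}jQ : (size Q <= j)%N by move: jQ; case: (size Q).
by rewrite !nth_default ?subrr ?sQ.
Qed.

(* Differencing [c b^n P + Q(n)] with lag [k.+1] multiplies [P] by
   [b^(k.+1) - 1] and lowers the degree of [Q]. *)
Lemma avg_cos_addpoly (c b : R) :
  (forall (ks : seq nat) (t : R), avg (fun n =>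
     cos (c * b ^+ n * \prod_(k <- ks) (b ^+ k.+1 - 1) + t)) N @[N --> \oo] --> 0) ->
  forall Q, avg (fun n => cos (c * b ^+ n + Q.[n%:R])) N @[N --> \oo] --> 0.
Proof.
move=> base Q.
(* The list [ks] records the lags already used, so it varies in the induction on the degree bound.
   Once constant, the polynomial is absorbed by the phase [t]. *)
suff H d : forall ks (P : {poly R}), (size P <= d.+1)%N -> avg (fun n =>
     cos (c * b ^+ n * \prod_(k <- ks) (b ^+ k.+1 - 1) + P.[n%:R])) N @[N --> \oo] --> 0.
  have := H (size Q) [::] Q (leqnSn _).
  by under [X in X @ _ --> _]eq_avg do rewrite big_nil mulr1.
elim: d => [|d ih] ks P sP.
  rewrite (size1_polyC sP).
  by under [X in X @ _ --> _]eq_avg do rewrite hornerC; exact: base.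
apply: van_der_corput => -[//|k] _.
pose D := P \Po ('X + k.+1%:R%:P) - P.
have := ih (k :: ks) D; rewrite [X in avg X](_ : _ = (fun n =>
  cos (c * b ^+ (n + k.+1) * \prod_(k <- ks) (b ^+ k.+1 - 1) + P.[(n + k.+1)%:R] -
    (c * b ^+ n * \prod_(k <- ks) (b ^+ k.+1 - 1) + P.[n%:R])))); last first.
  apply/funext => n; congr cos.
  rewrite /D big_cons hornerD hornerN horner_comp hornerD hornerX hornerC.
  by rewrite natrD exprD; ring.
apply; apply: (leq_trans (size_poly_diff _ _)).
by move: sP; case: (size P).
Qed.

End Differencing.

(** * Weyl's criterion *)

Section Weyl.
Context {R : realType}.
Implicit Types (a b t u : R) (x : nat -> R).

(** Telescoping of [2 sin a cos u = sin (u + a) - sin (u - a)]. *)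
Lemma dirichlet_kernel n a b : 2 * sin a * \sum_(k < n) cos (b + k%:R * (2 * a)) =
  sin (b + (n%:R * 2 - 1) * a) - sin (b - a).
Proof.
elim: n => [|n ih].
  by rewrite big_ord0 mulr0 mul0r sub0r mulN1r subrr.
rewrite big_ord_recr/= mulrDr ih.
have -> : b + (n.+1%:R * 2 - 1) * a = (b + n%:R * (2 * a)) + a.
  by rewrite -natr1; ring.
have -> : b + (n%:R * 2 - 1) * a = (b + n%:R * (2 * a)) - a by ring.
move: (sin (b - a)) => v; move: (b + _ * (2 * a)) => u.
by rewrite (sinD u a) (sinB u a); ring.
Qed.

(* [fejer n] is the Fejer kernel of order [n], scaled by [n^-1]. *)
Definition fejer n t : R :=
  n%:R^-2 * \sum_(k < n) \sum_(l < n) cos (2 * pi * (k%:R - l%:R) * t).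

(** The double sum is a squared modulus. Its sine part is written as cosines with phase [- pi / 2],
    so that [dirichlet_kernel] covers both parts. *)
Lemma fejerE n t : fejer n t = n%:R^-2 *
  ((\sum_(k < n) cos (0 + k%:R * (2 * (pi * t)))) ^+ 2 +
   (\sum_(k < n) cos (- (pi / 2) + k%:R * (2 * (pi * t)))) ^+ 2).
Proof.
rewrite /fejer; congr (_ * _).
set C := \sum_(k < n) cos (0 + _); set S := \sum_(k < n) cos (- _ + _).
rewrite !expr2 {1}/C {1}/S !mulr_suml -big_split/=; apply: eq_bigr => k _.
rewrite /C /S !mulr_sumr -big_split/=; apply: eq_bigr => l _.
rewrite !add0r ![- _ + _]addrC !cosBpihalf -cosB; congr cos; ring.
Qed.

Lemma fejer_ge0 n t : 0 <= fejer n t.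
Proof. by rewrite fejerE mulr_ge0 ?invr_ge0 ?sqr_ge0// addr_ge0 ?sqr_ge0. Qed.

(** By [dirichlet_kernel], [2 sin (pi t)] times either sum is a difference of two sines, of square
    at most 4. *)
Lemma fejer_le n t : sin (pi * t) ^+ 2 * fejer n t <= 2 / n%:R ^+ 2.
Proof.
rewrite fejerE mulrCA [leRHS]mulrC ler_wpM2l ?invr_ge0 ?sqr_ge0//.
have sub2 u v : (sin u - sin v) ^+ 2 <= 4.
  move: (sin_max u) (sin_max v); rewrite !ler_norml => /andP[? ?] /andP[? ?].
  nra.
have d1 := dirichlet_kernel n (pi * t) 0.
have d2 := dirichlet_kernel n (pi * t) (- (pi / 2)).
have := sub2 (0 + (n%:R * 2 - 1) * (pi * t)) (0 - pi * t).
have := sub2 (- (pi / 2) + (n%:R * 2 - 1) * (pi * t)) (- (pi / 2) - pi * t).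
rewrite -d1 -d2 !exprMn; lra.
Qed.

Lemma cosDnat2pi u m : cos (u + 2 * pi * m%:R) = cos u.
Proof.
rewrite -[RHS](periodicn (@cosD2pi R) m) -[_ *+ 2 *+ m]mulr_natr.
by rewrite -[pi *+ 2]mulr_natl.
Qed.

Lemma sinDnat2pi u m : sin (u + 2 * pi * m%:R) = sin u.
Proof.
rewrite -[RHS](periodicn (@sinD2pi R) m) -[_ *+ 2 *+ m]mulr_natr.
by rewrite -[pi *+ 2]mulr_natl.
Qed.

(** In [dirichlet_kernel] with [a = - pi m / n] the two sines differ by a full number of periods,
    while [sin a] is nonzero because [0 < m < n]. *)
Lemma sum_cos_roots n m u : (0 < m < n)%N ->
  \sum_(j < n) cos (2 * pi * m%:R * (u - j%:R / n%:R)) = 0.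
Proof.
move=> /andP[m0 mn].
have n0 : (0 : R) < n%:R by rewrite ltr0n (leq_trans _ mn).
have := dirichlet_kernel n (- (pi * m%:R / n%:R)) (2 * pi * m%:R * u).
rewrite (_ : _ + _ * - _ = 2 * pi * m%:R * u + pi * m%:R / n%:R - 2 * pi * m%:R); last first.
  by field; rewrite gt_eqF.
rewrite -[X in X - sin _](sinDnat2pi _ m) subrK opprK subrr.
rewrite sinN mulrN mulNr => /eqP; rewrite oppr_eq0 !mulf_eq0 pnatr_eq0/=.
rewrite gt_eqF/=; last first.
  apply: sin_gt0_pi; rewrite !mulr_gt0 ?pi_gt0 ?ltr0n ?invr_gt0//=.
  by rewrite ltr_pdivrMr// ltr_pM2l ?pi_gt0// ltr_nat.
move=> /eqP e; rewrite -[RHS]e; apply: eq_bigr => j _; congr cos.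
by field; rewrite gt_eqF.
Qed.

(** Summed over the grid, the terms with [k != l] vanish by [sum_cos_roots]; the [n] diagonal terms
    give [n] each. *)
Lemma sum_fejer n t : (0 < n)%N -> \sum_(j < n) fejer n (t - j%:R / n%:R) = 1.
Proof.
move=> n0; rewrite -mulr_sumr exchange_big/=.
rewrite (eq_bigr (fun=> n%:R)); last first.
  move=> k _; rewrite exchange_big/= (bigD1 k)//= [X in _ + X]big1 ?addr0.
    rewrite (eq_bigr (fun=> 1)) ?sumr_const ?card_ord// => j _.
    by rewrite subrr mulr0 mul0r cos0.
  move=> l lk.
  case: (ltngtP l k) => lk'; last by rewrite (val_inj lk') eqxx in lk.
    rewrite -(natrB _ (ltnW lk')) sum_cos_roots// subn_gt0 lk'/=.
    by rewrite (leq_ltn_trans (leq_subr _ _)).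
  rewrite (eq_bigr (fun j : 'I_n => cos (2 * pi * (l - k)%:R * (t - j%:R / n%:R)))).
    by rewrite sum_cos_roots// subn_gt0 lk'/= (leq_ltn_trans (leq_subr _ _)).
  by move=> j _; rewrite (natrB _ (ltnW lk')) -cosN; congr cos; ring.
rewrite sumr_const card_ord -[n%:R *+ _]mulr_natr.
by field; rewrite pnatr_eq0 -lt0n.
Qed.

Lemma cvg_avg_fejer x n u : (0 < n)%N ->
  (forall (k : nat) t, (0 < k)%N ->
    avg (fun i => cos (2 * pi * k%:R * x i + t)) N @[N --> \oo] --> 0) ->
  avg (fun i => fejer n (x i - u)) N @[N --> \oo] --> (n%:R^-1 : R).
Proof.
move=> n0 xk.
have n0' : n%:R != 0 :> R by rewrite pnatr_eq0 -lt0n.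
have pairs (k l : nat) : avg (fun i => cos (2 * pi * (k%:R - l%:R) * (x i - u))) N
    @[N --> \oo] --> ((l == k)%:R : R).
  case: (ltngtP l k) => [lk|lk|<-].
  - have := xk (k - l)%N (- (2 * pi * (k - l)%:R * u)); rewrite subn_gt0 => /(_ lk).
    rewrite (natrB _ (ltnW lk)); under eq_avg do rewrite -mulrBr; exact.
  - have := xk (l - k)%N (- (2 * pi * (l - k)%:R * u)); rewrite subn_gt0 => /(_ lk).
    rewrite (natrB _ (ltnW lk)); under eq_avg do rewrite -mulrBr.
    rewrite (@eq_avg _ _ (fun i => cos (2 * pi * (k%:R - l%:R) * (x i - u))))//.
    by move=> i; rewrite -cosN; congr cos; ring.
  - apply: cvg_near_cst; near=> N.
    rewrite /avg (eq_bigr (fun=> 1)) ?sumr_const ?card_ord ?divff//=.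
      by rewrite pnatr_eq0 -lt0n; near: N; exists 1%N.
    by move=> i _; rewrite subrr mulr0 mul0r cos0.
rewrite [X in X @ _](_ : _ = (fun N => n%:R^-2 * \sum_(k < n) \sum_(l < n)
   avg (fun i => cos (2 * pi * (k%:R - l%:R) * (x i - u))) N)); last first.
  apply/funext => N; rewrite avgZ avg_sum; congr (_ * _).
  by apply: eq_bigr => k _; rewrite avg_sum.
have -> : n%:R^-1 = n%:R^-2 * \sum_(k < n) \sum_(l < n) (l == k :> nat)%:R :> R.
  rewrite (eq_bigr (fun=> 1)).
    by rewrite sumr_const card_ord; field.
  move=> k _; rewrite (bigD1 k)//= eqxx [X in _ + X]big1 ?addr0// => l /negbTE lk.
  by rewrite -[(l == k :> nat)]/(l == k) lk.
by apply: cvgMr; apply: cvg_sumr => k; apply: cvg_sumr => l; exact: pairs.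
Unshelve. all: by end_near. Qed.

(** Written as [(1 - cos (2 pi t)) / 2], the squared sine is even, increases on [[0, 1/2]] and is
    symmetric about [1/2]. *)
Lemma sin_pi_ge d t : 0 < d -> d <= `|t| -> `|t| <= 1 - d ->
  sin (pi * d) ^+ 2 <= sin (pi * t) ^+ 2.
Proof.
move=> d0; wlog t0 : t / 0 <= t.
  move=> wl dt td; have [|/ltW] := leP 0 t; first by move/wl; apply.
  by rewrite -oppr_ge0 => /wl; rewrite normrN mulrN sinN sqrrN; apply.
rewrite ger0_norm// => dt td.
have p0 := @pi_gt0 R.
have sin_sqr u : sin u ^+ 2 = (1 - cos (2 * u)) / 2.
  by rewrite mulr_natl cos_mulr2n sin2cos2; field.
rewrite !sin_sqr ler_pM2r ?invr_gt0// lerB//.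
have mono u v : 0 <= u -> u <= v -> v <= pi -> cos v <= cos u.
  move=> u0 uv vp; rewrite le_eqVlt; move: uv; rewrite le_eqVlt => /predU1P[->|uv].
    by rewrite eqxx.
  by rewrite ltr_cos ?uv ?orbT// in_itv/=; nra.
have [th|th] := leP t (2^-1); first by apply: mono; nra.
rewrite -(cosN (2 * (pi * t))) -(cosDnat2pi (- _) 1) mulr1.
by apply: mono; nra.
Qed.

Lemma sin_sqr_frac t u : sin (pi * (t - u)) ^+ 2 = sin (pi * (frac_part t - u)) ^+ 2.
Proof.
have natpi (v : R) (m : nat) : sin (v + pi * m%:R) ^+ 2 = sin v ^+ 2.
  elim: m => [|m ih]; first by rewrite mulr0 addr0.
  by rewrite -natr1 mulrDr mulr1 addrA sinDpi sqrrN.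
rewrite /frac_part; case: (Num.floor t) => m.
  by rewrite -[RHS](natpi _ m); congr (sin _ ^+ 2); rewrite -pmulrn; ring.
rewrite NegzE -[LHS](natpi _ m.+1); congr (sin _ ^+ 2).
by rewrite mulrNz -pmulrn; ring.
Qed.

Lemma count_fracE x a b N : (count_frac x a b N)%:R =
  \sum_(i < N) (frac_part (x i.+1) \in `[a, b])%:R :> R.
Proof.
rewrite /count_frac -sum1_count big_mkcond/= natr_sum.
rewrite (_ : iota 1 N = index_iota 1 N.+1); last by rewrite /index_iota subSS subn0.
by rewrite big_add1 big_mkord; apply: eq_bigr => i _; case: ifP.
Qed.

Lemma frac_part_itv t : 0 <= frac_part t < 1.
Proof.
by rewrite /frac_part subr_ge0 floor_le_tmp ltrBlDr addrC -intrD1 floorD1_gt.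
Qed.

Lemma avg_cst t N : avg (fun=> t) N = (N != 0)%N%:R * t.
Proof.
rewrite /avg sumr_const card_ord; case: N => [|N]/=; first by rewrite mulr0n !mul0r.
by rewrite mul1r -[t *+ _]mulr_natr mulfK// pnatr_eq0.
Qed.

(** If the fractional part lies in [[a, b]], the partition of unity bounds the sum by 1. Otherwise
    it stays at distance at least [d], modulo 1, from every grid point of the window, and each of
    the at most [n] terms is small by [fejer_le]. *)
Lemma fejer_window_le n (p q : nat) a b d t : (0 < n)%N -> (p <= q <= n)%N ->
  0 < d < 2^-1 -> 0 <= a -> b <= 1 ->
  (forall j, (p <= j < q)%N -> a + d <= j%:R / n%:R <= b - d) ->
  \sum_(p <= j < q) fejer n (t - j%:R / n%:R) <=
    (frac_part t \in `[a, b])%:R + 2 / (n%:R * sin (pi * d) ^+ 2).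
Proof.
move=> n0 /andP[pq qn] /andP[d0 d1] a0 b1 pqd.
have n0' : (0 : R) < n%:R by rewrite ltr0n.
have s0 : 0 < sin (pi * d) ^+ 2.
  rewrite exprn_gt0// sin_gt0_pi// mulr_gt0 ?pi_gt0//=.
  by rewrite -[ltRHS]mulr1 ltr_pM2l ?pi_gt0//; lra.
have [_|tab] := boolP (frac_part t \in `[a, b]).
  rewrite -[leLHS]addr0 lerD//; last by rewrite divr_ge0// mulr_ge0// ltW.
  rewrite /= mulr1n -[leRHS](sum_fejer t n0).
  rewrite -(big_mkord xpredT (fun j => fejer n (t - j%:R / n%:R))).
  rewrite (big_cat_nat (leq0n q) qn)/= (big_cat_nat (leq0n p) pq)/=.
 rewrite [X in _ <= X + _]addrC -addrA. rewrite lerDl.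
  by rewrite addr_ge0// sumr_ge0// => j _; exact: fejer_ge0.
rewrite add0r.
apply: (@le_trans _ _ (\sum_(p <= j < q) 2 / (n%:R ^+ 2 * sin (pi * d) ^+ 2))).
  apply: ler_sum_nat => j pjq.
  rewrite invfM mulrA ler_pdivlMr// mulrC.
  apply: (le_trans _ (fejer_le n (t - j%:R / n%:R))).
  rewrite ler_wpM2r ?fejer_ge0// sin_sqr_frac.
  have := pqd _ pjq; have := frac_part_itv t; move: tab; rewrite in_itv/= negb_and -!ltNge.
  move: (frac_part t) (j%:R / n%:R) => u v uab /andP[u0 u1] /andP[av vb].
  have [uv|uv] := leP 0 (u - v); apply: sin_pi_ge => //.
  - by rewrite ger0_norm//; case/orP: uab; lra.
  - by rewrite ger0_norm//; lra.
  - by rewrite ltr0_norm//; case/orP: uab; lra.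
  - by rewrite ltr0_norm//; lra.
rewrite sumr_const_nat -[leLHS]mulr_natr.
have -> : 2 / (n%:R * sin (pi * d) ^+ 2) = 2 / (n%:R ^+ 2 * sin (pi * d) ^+ 2) * n%:R.
  by move: (sin _ ^+ 2) s0 => s s0; field; rewrite !gt_eqF.
rewrite ler_wpM2l//; first by rewrite divr_ge0// mulr_ge0// ?sqr_ge0// ltW.
rewrite ler_nat.
by rewrite (leq_trans (leq_subr _ _)).
Qed.

Section criterion.
Variable x : nat -> R.
Hypothesis xk : forall (k : nat) t, (0 < k)%N ->
  avg (fun i => cos (2 * pi * k%:R * x i.+1 + t)) N @[N --> \oo] --> 0.

Lemma count_frac_lower a b e : 0 <= a -> b <= 1 -> 0 < e ->
  \forall N \near \oo, b - a - e <= (count_frac x a b N)%:R / N%:R.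
Proof.
move=> a0 b1 e0; have [bae|abe] := leP (b - a) e.
  by apply: nearW => N; rewrite (@le_trans _ _ 0) ?divr_ge0// subr_le0.
(* Error budget: shrinking the interval by [d] at both ends and rounding to the grid cost [3 e / 8],
   the passage to the limit [e / 8], the kernel tails [e / 8]. *)
pose d := e / 8.
have p0 := @pi_gt0 R.
have truncn_le' r : 0 <= r -> (Num.truncn r)%:R <= r :> R by rewrite truncn_le.
have s0 : 0 < sin (pi * d) ^+ 2.
  rewrite exprn_gt0// sin_gt0_pi// mulr_gt0//= /d; last lra.
  by rewrite -[ltRHS]mulr1 ltr_pM2l; lra.
pose S := 2 / sin (pi * d) ^+ 2.
(* The bound [n > M] makes both [1 / n] and [S / n] at most [e / 8]. *)
pose M := 8 / e * (S + 1).
pose n := (Num.truncn M).+1.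
have n0 : (0 < n)%N by [].
have n0' : (0 : R) < n%:R by rewrite ltr0n.
have Mn : M < n%:R by exact: truncnS_gt.
have SM : S + 1 <= e / 8 * n%:R.
  rewrite (_ : S + 1 = e / 8 * M); last by rewrite /M; field; rewrite gt_eqF.
  by rewrite ler_pM2l ?divr_gt0// ltW.
have S0 : 0 < S by rewrite divr_gt0.
have n1 : n%:R^-1 <= e / 8.
  by rewrite -[leLHS]mul1r ler_pdivrMr// (le_trans _ SM)// lerDr ltW.
have n2 : 2 / (n%:R * sin (pi * d) ^+ 2) <= e / 8.
  rewrite [_ * sin _ ^+ 2]mulrC invfM mulrA -/S ler_pdivrMr// (le_trans _ SM)//.
  by rewrite lerDl.
(* The indices [p <= j < q] are those with [j / n] above [a + d] and at most [b - d]. *)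
pose p := (Num.truncn (n%:R * (a + d))).+1.
pose q := (Num.truncn (n%:R * (b - d))).+1.
have ad0 : 0 <= n%:R * (a + d) by rewrite mulr_ge0 ?ltW// /d; lra.
have bd0 : 0 <= n%:R * (b - d) by rewrite mulr_ge0 ?ltW// /d; lra.
have pq : (p <= q)%N.
  by rewrite ltnS; apply: le_truncn; rewrite ler_pM2l// /d; lra.
have qn : (q <= n)%N.
  rewrite -(ltr_nat R) (@le_lt_trans _ _ (n%:R * (b - d))) ?truncn_le'//.
  by rewrite -[ltRHS]mulr1 ltr_pM2l// /d; lra.
have window j : (p <= j < q)%N -> a + d <= j%:R / n%:R <= b - d.
  move=> /andP[pj jq]; rewrite ler_pdivlMr// ler_pdivrMr// ![_ * n%:R]mulrC; apply/andP; split.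
    rewrite (le_trans (ltW (truncnS_gt _)))// ler_nat//.
  by rewrite (le_trans _ (truncn_le' _ bd0))// ler_nat -ltnS.
have pqE : b - a - 3 * e / 8 <= (q - p)%:R * n%:R^-1.
  rewrite /q /p subSS natrB//.
  have t1 := truncn_le' _ ad0.
  have t2 : n%:R * (b - d) < (Num.truncn (n%:R * (b - d)))%:R + 1 by rewrite natr1 truncnS_gt.
  rewrite ler_pdivlMr//.
  have : 1 <= n%:R * e / 8 by move: n1; rewrite -(ler_pM2l n0') mulfV ?gt_eqF// mulrA.
  by move: t1 t2; rewrite /d; lra.
have cvgw : \sum_(p <= j < q) avg (fun i => fejer n (x i.+1 - j%:R / n%:R)) N
    @[N --> \oo] --> ((q - p)%:R * n%:R^-1 : R).
  have := @cvg_sumr R nat (index_iota p q) (fun j => avg (fun i => fejer n (x i.+1 - j%:R / n%:R)))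
    (fun=> n%:R^-1) (fun j => cvg_avg_fejer (j%:R / n%:R) n0 xk).
  by rewrite sumr_const_nat mulr_natl.
near=> N.
have N0 : (N != 0)%N by rewrite -lt0n; near: N; exists 1%N.
have h1 : (q - p)%:R * n%:R^-1 - e / 8 <=
    \sum_(p <= j < q) avg (fun i => fejer n (x i.+1 - j%:R / n%:R)) N.
  rewrite lerBlDr -lerBlDl (le_trans (ler_norm _))//; near: N.
  by move/cvgrPdist_le : cvgw; apply; rewrite divr_gt0.
have : \sum_(p <= j < q) avg (fun i => fejer n (x i.+1 - j%:R / n%:R)) N <=
    (count_frac x a b N)%:R / N%:R + e / 8.
  have ce : avg (fun=> e / 8) N = e / 8 by rewrite avg_cst N0 mul1r.
  rewrite count_fracE -avg_sum -[X in _ <= _ + X]ce.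
  rewrite -[X in _ <= X + _]/(avg (fun i => (frac_part (x i.+1) \in `[a, b])%:R) N).
  rewrite -avgD; apply: ler_avg => i.
  apply: (le_trans (fejer_window_le _ n0 _ _ a0 b1 window)) => //.
  - by rewrite pq.
  - by rewrite /d; lra.
  - by rewrite lerD2l.
lra.
Unshelve. all: by end_near. Qed.

(** The upper bound follows from lower bounds on the two complementary intervals. Gaps of [e / 4]
    keep the three closed intervals disjoint, and these gaps with two further errors [e / 4] add up
    to [e]. *)
Lemma weyl_criterion : unif_distributed_mod1 x.
Proof.
move=> a b a0 ab b1; apply/cvgrPdist_le => e e0.
near=> N.
have N0 : (0 < N)%N by near: N; exists 1%N.
have h1 : b - a - e <= (count_frac x a b N)%:R / N%:R by near: N; exact: count_frac_lower.
have h2 : (a - e / 4) - 0 - e / 4 <= (count_frac x 0 (a - e / 4) N)%:R / N%:R.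
  by near: N; apply: count_frac_lower; lra.
have h3 : 1 - (b + e / 4) - e / 4 <= (count_frac x (b + e / 4) 1 N)%:R / N%:R.
  by near: N; apply: count_frac_lower; lra.
have : (count_frac x 0 (a - e / 4) N)%:R / N%:R + (count_frac x a b N)%:R / N%:R +
    (count_frac x (b + e / 4) 1 N)%:R / N%:R <= 1 :> R.
  rewrite -!mulrDl ler_pdivrMr ?ltr0n// mul1r !count_fracE -!big_split/=.
  rewrite [leRHS](_ : _ = \sum_(i < N) 1); last by rewrite sumr_const card_ord.
  apply: ler_sum => i _.
  rewrite !in_itv/=; move: (frac_part _) => u.
  have [u1|u1] := leP u (a - e / 4); have [u2|u2] := leP a u; have [u3|u3] := leP u b;
    have [u4|u4] := leP (b + e / 4) u; rewrite ?andbF ?andbT; try lra;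
    case: (0 <= u); case: (u <= 1) => /=; lra.
rewrite ler_norml; lra.
Unshelve. all: by end_near. Qed.

End criterion.

End Weyl.

(** * Integrals over a segment *)

Section SegmentIntegral.
Context {R : realType} (a b : R) (ab : a < b).
Local Notation mu := (@lebesgue_measure R).
Implicit Types (f g : R -> R).

Lemma continuous_within_integrable f :
  {within `[a, b], continuous f} -> mu.-integrable `[a, b] (EFin \o f).
Proof. by move=> cf; apply: continuous_compact_integrable => //; exact: segment_compact. Qed.

Lemma eq_within_continuous f g : f =1 g ->
  {within `[a, b], continuous f} -> {within `[a, b], continuous g}.
Proof. by move=> /funext ->. Qed.

Lemma within_continuous_cst (k : R) : {within `[a, b], continuous (fun=> k)}.
Proof. by move=> x; exact: cvg_cst. Qed.

Lemma within_continuousD f g : {within `[a, b], continuous f} ->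
  {within `[a, b], continuous g} -> {within `[a, b], continuous (fun x => f x + g x)}.
Proof. by move=> cf cg x; apply: cvgD; [exact: cf|exact: cg]. Qed.

Lemma within_continuousM f g : {within `[a, b], continuous f} ->
  {within `[a, b], continuous g} -> {within `[a, b], continuous (fun x => f x * g x)}.
Proof. by move=> cf cg x; apply: cvgM; [exact: cf|exact: cg]. Qed.

Lemma within_continuous_comp (h : R -> R) f : continuous h ->
  {within `[a, b], continuous f} -> {within `[a, b], continuous (fun x => h (f x))}.
Proof. by move=> ch cf x; apply: (continuous_comp (cf x)); exact: ch. Qed.

Lemma Rintegral_continuousD f g : {within `[a, b], continuous f} ->
  {within `[a, b], continuous g} ->
  (\int[mu]_(x in `[a, b]) (f x + g x) =
   \int[mu]_(x in `[a, b]) f x + \int[mu]_(x in `[a, b]) g x)%R.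
Proof.
by move=> cf cg; rewrite RintegralD//; exact: continuous_within_integrable.
Qed.

Lemma Rintegral_continuousZ (k : R) f : {within `[a, b], continuous f} ->
  (\int[mu]_(x in `[a, b]) (k * f x) = k * \int[mu]_(x in `[a, b]) f x)%R.
Proof.
by move=> cf; rewrite RintegralZl//; exact: continuous_within_integrable.
Qed.

Lemma Rintegral_cst_itv (k : R) : (\int[mu]_(x in `[a, b]) k = k * (b - a))%R.
Proof.
by rewrite Rintegral_cst//= lebesgue_measure_itv/= lte_fin ab.
Qed.

(* The first derivative test: [(sin f - 1) / f'] has a derivative that
   dominates [cos f]. *)
Lemma Rintegral_cos_le (f f1 f2 : R -> R) (l : R) : 0 < l ->
  (forall x, a <= x <= b -> is_derive x 1 f (f1 x)) ->
  (forall x, a <= x <= b -> is_derive x 1 f1 (f2 x)) ->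
  {within `[a, b], continuous f2} ->
  (forall x, a <= x <= b -> l <= f1 x) ->
  (forall x, a <= x <= b -> 0 <= f2 x) ->
  (\int[mu]_(x in `[a, b]) cos (f x) <= 2 / l)%R.
Proof.
move=> l0 df df1 cf2 lf1 f20.
have f1_gt0 x : a <= x <= b -> 0 < f1 x by move=> /lf1; exact: lt_le_trans.
(* Subtracting 1 from the sine makes the extra term [q x * f2 x] of the derivative nonnegative, and
   also [P b <= 0]; only [- P a <= 2 / l] remains. *)
pose P x := (sin (f x) - 1) * (f1 x)^-1.
pose q x := (1 - sin (f x)) * ((f1 x)^-1 * (f1 x)^-1).
pose p x := cos (f x) + q x * f2 x.
have aab : a <= a <= b by rewrite lexx ltW.
have abb : a <= b <= b by rewrite lexx ltW.
have dV x : a <= x <= b -> is_derive x 1 (fun y => (f1 y)^-1) (- (f1 x) ^- 2 *: f2 x).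
  by move=> xab; have ? := df1 x xab; apply: is_deriveV; rewrite gt_eqF// f1_gt0.
have dS x : a <= x <= b -> is_derive x 1 (fun y => sin (f y)) (cos (f x) * f1 x).
  by move=> xab; have ? := df x xab; apply: is_derive1_comp.
have dP x : a <= x <= b -> is_derive x 1 P (p x).
  move=> xab; have ? := dV x xab; have ? := dS x xab.
  have f1x := f1_gt0 _ xab.
  apply: is_derive_eq.
  rewrite /p /q /GRing.scale/= subr0.
  by field; rewrite gt_eqF.
have cP x : a <= x <= b -> {for x, continuous P}.
  move=> xab; have [+ _] := dP x xab.
  by move=> /derivable1_diffP /differentiable_continuous.
have cont (h h' : R -> R) : (forall x, a <= x <= b -> is_derive x 1 h (h' x)) ->
    {within `[a, b], continuous h}.
  move=> dh; apply: derivable_within_continuous => x; rewrite in_itv/= => xab.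
  by case: (dh x xab).
have cf : {within `[a, b], continuous f} by exact: cont df.
have cV : {within `[a, b], continuous (fun y => (f1 y)^-1)} by exact: cont dV.
have ccos : {within `[a, b], continuous (fun x => cos (f x))}.
  by apply: within_continuous_comp => //; exact: continuous_cos.
have cp : {within `[a, b], continuous p}.
  apply: within_continuousD => //; apply: within_continuousM => //.
  apply: within_continuousM; last exact: within_continuousM.
  apply: (@within_continuous_comp (fun y => 1 - sin y)) => // y.
  by apply: cvgB; [exact: cvg_cst|exact: continuous_sin].
have intp : (\int[mu]_(x in `[a, b]) p x = P b - P a)%R.
  rewrite /Rintegral (@continuous_FTC2 _ p P)//.
    split; [|exact: (cvg_at_right_filter (cP _ aab))|exact: (cvg_at_left_filter (cP _ abb))].
    by move=> x; rewrite in_itv/= => /andP[ax xb]; have [] := dP x; rewrite ?ltW.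
  move=> x; rewrite in_itv/= => /andP[ax xb].
  have xab : a <= x <= b by rewrite !ltW.
  by have ? := dP x xab; rewrite derive1E derive_val.
apply: (@le_trans _ _ (\int[mu]_(x in `[a, b]) p x)%R).
  apply: le_Rintegral => //; [exact: continuous_within_integrable..|].
  move=> x/=; rewrite in_itv/= => xab; rewrite /p lerDl mulr_ge0 ?f20//.
  rewrite mulr_ge0 ?subr_ge0 ?sin_le1//.
  by rewrite mulr_ge0// invr_ge0 ltW ?f1_gt0.
rewrite intp /P.
have hb : (sin (f b) - 1) * (f1 b)^-1 <= 0.
  by rewrite mulr_le0_ge0 ?subr_le0 ?sin_le1// invr_ge0 ltW ?f1_gt0.
have ha : (1 - sin (f a)) * (f1 a)^-1 <= 2 / l.
  rewrite ler_pM// ?subr_ge0 ?sin_le1//.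
  - by rewrite invr_ge0 ltW ?f1_gt0.
  - by have := sin_geN1 (f a); lra.
  - by rewrite lef_pV2 ?posrE ?f1_gt0// lf1.
move: ha hb; lra.
Qed.

(** By monotone convergence the sum of all [h j] is integrable, hence finite almost everywhere, and
    the terms of a convergent series tend to 0. *)
Lemma ae_cvg0_of_sum_Rintegral (h : nat -> R -> R) (K : R) :
  (forall j x, 0 <= h j x) -> (forall j, {within `[a, b], continuous (h j)}) ->
  (forall j, \int[mu]_(x in `[a, b]) h j x <= K / j.+1%:R ^+ 2)%R ->
  {ae mu, forall x, a <= x <= b -> h j x @[j --> \oo] --> 0}.
Proof.
move=> h0 ch hK.
have ih j := continuous_within_integrable (ch j).
have mh j := measurable_int mu (ih j).
have mabs : measurable (`[a, b]%classic : set (measurableTypeR R)) by exact: measurable_itv.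
pose F x := (\sum_(j <oo) (h j x)%:E)%E.
have F0 x : (0 <= F x)%E by apply: nneseries_ge0 => j _ _; rewrite lee_fin.
have intF : (\int[mu]_(x in `[a, b]) F x <= (2 * `|K|)%:E)%E.
  rewrite integral_nneseries//; last by move=> j x _; rewrite lee_fin.
  apply: lime_le.
    apply: is_cvg_nneseries => j _ _; apply: integral_ge0 => x _; rewrite lee_fin//.
  apply: nearW => n.
  have -> : (\sum_(0 <= j < n) \int[mu]_(x in `[a, b]) (h j x)%:E =
      (\sum_(0 <= j < n) (\int[mu]_(x in `[a, b]) h j x)%R)%:E)%E.
    rewrite -sumEFin; apply: eq_bigr => j _; rewrite /Rintegral fineK//.
    by apply: integrable_fin_num => //; exact: ih.
  rewrite lee_fin; apply: (@le_trans _ _ (\sum_(0 <= j < n) `|K| / j.+1%:R ^+ 2)).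
    apply: ler_sum => j _; apply: (le_trans (hK j)).
    by rewrite ler_wpM2r ?invr_ge0 ?sqr_ge0// ler_norm.
  rewrite -mulr_sumr mulrC ler_wpM2r//.
  (* The term [2 / n.+1] makes the induction work, since [1 / u^2 <= 2 / u - 2 / (u + 1)] for
     [u >= 1]. *)
  suff : \sum_(0 <= j < n) (j.+1%:R ^+ 2)^-1 <= 2 - 2 / n.+1%:R :> R.
    by move=> /le_trans; apply; rewrite gerBl divr_ge0.
  elim: n => [|n ihn]; first by rewrite big_nil divr1 subrr.
  rewrite big_nat_recr//= (le_trans (lerD ihn (lexx _)))//.
  have n0 : (1 : R) <= n.+1%:R by rewrite ler1n.
  rewrite -[n.+2%:R]natr1; move: (n.+1%:R) n0 => u u1.
  have u0 : 0 < u by exact: lt_le_trans u1.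
  rewrite -subr_ge0 (_ : _ - _ = (u - 1) / (u ^+ 2 * (u + 1))); last first.
    by field; rewrite !gt_eqF// addr_gt0.
  by rewrite divr_ge0 ?subr_ge0// mulr_ge0 ?sqr_ge0// addr_ge0 ?ltW.
have iF : mu.-integrable `[a, b] F.
  apply/integrableP; split.
  - apply: (@ge0_emeasurable_sum _ _ _ _ (fun j x => (h j x)%:E) xpredT) => //.
      by move=> j x _ _; rewrite lee_fin.
    by move=> j _; exact: mh.
  - rewrite (_ : integral _ _ _ = \int[mu]_(x in `[a, b]) F x)%E; last first.
    by apply: eq_integral => x _; rewrite gee0_abs.
  by rewrite (le_lt_trans intF)// ltry.
have := integrable_ae mabs iF; apply: filterS => x /= Fx xab.
have Ffin : F x \is a fin_num by apply: Fx => /=; rewrite in_itv.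
apply: cvg_series_cvg_0; apply: nondecreasing_is_cvgn.
  by apply/nondecreasing_seqP => n; rewrite /series/= big_nat_recr//= lerDl.
exists (fine (F x)) => _ [n _ <-].
rewrite -lee_fin fineK// /series/= -sumEFin.
by apply: nneseries_lim_ge => j _ _; rewrite lee_fin.
Qed.

End SegmentIntegral.

(** * From mean-square bounds to convergence almost everywhere *)

Section AlmostEverywhere.
Context {R : realType} (a b : R) (ab : a < b).
Local Notation mu := (@lebesgue_measure R).
Implicit Types (f : nat -> R -> R) (y : nat -> R) (t : R).

Lemma within_continuous_sum f N : (forall n, {within `[a, b], continuous (f n)}) ->
  {within `[a, b], continuous (fun x => \sum_(n < N) f n x)}.
Proof.
move=> cf; elim: N => [|N ih].
  apply: (@eq_within_continuous _ _ _ (fun=> 0)); last exact: within_continuous_cst.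
  by move=> x; rewrite big_ord0.
apply: (@eq_within_continuous _ _ _ (fun x => (\sum_(n < N) f n x) + f N x)).
  by move=> x; rewrite big_ord_recr.
exact: within_continuousD.
Qed.

(* The square of the modulus of [\sum_(n < N) exp (i y n)]. *)
Definition energy (y : nat -> R) N : R :=
  (\sum_(n < N) cos (y n)) ^+ 2 + (\sum_(n < N) sin (y n)) ^+ 2.

Lemma energy_ge0 y N : 0 <= energy y N.
Proof. by rewrite addr_ge0 ?sqr_ge0. Qed.

Lemma energyS y N : energy y N.+1 =
  energy y N + (1 + 2 * \sum_(m < N) cos (y N - y m)).
Proof.
rewrite /energy !big_ord_recr/=.
have -> : \sum_(m < N) cos (y N - y m) =
    cos (y N) * (\sum_(m < N) cos (y m)) + sin (y N) * (\sum_(m < N) sin (y m)).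
  by rewrite !mulr_sumr -big_split/=; apply: eq_bigr => m _; rewrite cosB.
rewrite -{1}(cos2Dsin2 (y N)); ring.
Qed.

(** The left side is the squared real part of the exponential sum rotated by [t]; the discarded
    square is that of its imaginary part. *)
Lemma sqr_sum_cos_le y N t : (\sum_(n < N) cos (y n + t)) ^+ 2 <= energy y N.
Proof.
rewrite /energy; set C := \sum_(n < N) cos (y n); set S := \sum_(n < N) sin (y n).
have -> : \sum_(n < N) cos (y n + t) = cos t * C - sin t * S.
  rewrite /C /S !mulr_sumr -sumrB; apply: eq_bigr => n _.
  by rewrite cosD mulrC [sin _ * _]mulrC.
have := sqr_ge0 (sin t * C + cos t * S).
rewrite -[C ^+ 2 + _]mul1r -(cos2Dsin2 t); nra.
Qed.

(** Between consecutive squares at most [2 (j + 1)] terms are added, negligible against [(j + 1)^2].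
    The hypothesis is free of [t], so one null set will serve all phases. *)
Lemma avg_cos_of_squares y :
  energy y (j.+1 ^ 2) / (j.+1%:R ^+ 2) ^+ 2 @[j --> \oo] --> (0 : R) ->
  forall t, avg (fun n => cos (y n + t)) N @[N --> \oo] --> 0.
Proof.
move=> yE t; apply/cvgrPdist_le => e e0.
have /cvgrPdist_le/(_ ((e / 2) ^+ 2)) := yE.
rewrite exprn_gt0 ?divr_gt0// => /(_ isT) [J1 _ HJ1].
(* For [j >= J2] the remainder satisfies [2 (j + 1) <= (e / 2) (j + 1)^2]. *)
pose J2 := Num.truncn (4 / e).
exists ((maxn J1 J2).+1 ^ 2)%N => // N /= JN.
have [j /andP[jN Nj]] : exists j, (j.+1 ^ 2 <= N < j.+2 ^ 2)%N.
  have : (0 < N)%N by rewrite (leq_trans _ JN)// expn_gt0.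
  elim: {JN} N => // -[_ _|N /(_ isT) [j /andP[jN Nj]] _]; first by exists 0%N.
  move: Nj; rewrite leq_eqVlt => /predU1P[Ne|Nj].
    by exists j.+1; rewrite Ne leqnn/= ltn_exp2r.
  by exists j; rewrite Nj andbT leqW.
have : (maxn J1 J2 <= j)%N.
  by rewrite -2!ltnS -(@ltn_exp2r _ _ 2)//; exact: leq_ltn_trans JN Nj.
rewrite geq_max => /andP[J1j J2j].
have N0 : (0 : R) < N%:R by rewrite ltr0n (leq_trans _ jN)// expn_gt0.
rewrite sub0r normrN /avg normrM normfV normr_nat ler_pdivrMr//.
have M2 : `|\sum_(n < j.+1 ^ 2) cos (y n + t)| <= e / 2 * j.+1%:R ^+ 2.
  have j0 : (0 : R) < j.+1%:R ^+ 2 by rewrite exprn_gt0.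
  rewrite -ler_sqr ?nnegrE ?mulr_ge0 ?divr_ge0 ?(ltW e0) ?(ltW j0)//.
  rewrite real_normK ?num_real// exprMn (le_trans (sqr_sum_cos_le y _ t))//.
  rewrite -ler_pdivrMr ?exprn_gt0//.
  have := HJ1 j J1j; rewrite sub0r normrN; exact: le_trans (ler_norm _).
have M3 : `|\sum_(j.+1 ^ 2 <= n < N) cos (y n + t)| <= e / 2 * j.+1%:R ^+ 2.
  apply: (le_trans (ler_norm_sum _ _ _)).
  apply: (@le_trans _ _ (\sum_(j.+1 ^ 2 <= n < N) 1)).
    by apply: ler_sum => n _; exact: cos_max.
  rewrite sumr_const_nat; apply: (@le_trans _ _ (2 * j.+1%:R)).
    by rewrite -natrM ler_nat leq_subLR -ltnS (leq_trans Nj)//; nia.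
  have : 4 / e <= j.+1%:R.
    by rewrite (le_trans (ltW (truncnS_gt _)))// ler_nat.
  rewrite ler_pdivrMr// expr2 mulrA ler_pM2r//; lra.
rewrite -(big_mkord xpredT (fun n => cos (y n + t))) (big_cat_nat (leq0n _) jN)/=.
rewrite (le_trans (ler_normD _ _))// big_mkord (le_trans (lerD M2 M3))//.
by rewrite -mulrDl -splitr ler_pM2l// -natrX ler_nat.
Qed.

Lemma within_continuous_energy f N : (forall n, {within `[a, b], continuous (f n)}) ->
  {within `[a, b], continuous (fun x => energy (f ^~ x) N)}.
Proof.
move=> cf.
have csqr (g : R -> R) : continuous g ->
    {within `[a, b], continuous (fun x => (\sum_(n < N) g (f n x)) ^+ 2)}.
  move=> cg.
  apply: (@eq_within_continuous _ _ _
    (fun x => (\sum_(n < N) g (f n x)) * (\sum_(n < N) g (f n x)))) => //.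
  by apply: within_continuousM; apply: (@within_continuous_sum (fun n x => g (f n x))) => n;
    exact: within_continuous_comp.
by apply: within_continuousD; apply: csqr; [exact: continuous_cos|exact: continuous_sin].
Qed.

(** By [energyS], step [N] adds [b - a] and twice [N] cross integrals of size at most [C / (N + 1)]:
    their decay offsets their number. *)
Lemma Rintegral_energy_le f C N : 0 <= C ->
  (forall n, {within `[a, b], continuous (f n)}) ->
  (forall m n, (m < n)%N -> \int[mu]_(x in `[a, b]) cos (f n x - f m x) <= C / n.+1%:R)%R ->
  (\int[mu]_(x in `[a, b]) energy (f ^~ x) N <= (b - a + 2 * C) * N%:R)%R.
Proof.
move=> C0 cf fC.
have cB n m : {within `[a, b], continuous (fun x => cos (f n x - f m x))}.
  apply: within_continuous_comp; first exact: continuous_cos.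
  by move=> x; apply: cvgB; exact: cf.
have cE k := @within_continuous_energy f k cf.
have cst_cont := @within_continuous_cst R a b.
have sum_le n k : (k <= n)%N ->
    (\int[mu]_(x in `[a, b]) (\sum_(m < k) cos (f n x - f m x)) <= k%:R * (C / n.+1%:R))%R.
  elim: k => [_|k ih kn].
    under eq_Rintegral do rewrite big_ord0.
    by rewrite Rintegral_cst_itv// mul0r mul0r.
  under eq_Rintegral do rewrite big_ord_recr/=.
  rewrite Rintegral_continuousD//; last exact: (@within_continuous_sum (fun m x => cos (f n x - f m x))).
  by rewrite -natr1 mulrDl mul1r lerD ?ih ?fC// ltnW.
elim: N => [|N ih].
  under eq_Rintegral do rewrite /energy !big_ord0 expr0n/= addr0.
  by rewrite Rintegral_cst_itv// mul0r mulr0.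
under eq_Rintegral do rewrite energyS.
have cS : {within `[a, b], continuous (fun x => \sum_(m < N) cos (f N x - f m x))}.
  exact: (@within_continuous_sum (fun m x => cos (f N x - f m x))).
rewrite Rintegral_continuousD//; last first.
  by apply: within_continuousD => //; apply: within_continuousM.
rewrite -[N.+1%:R]natr1 mulrDr mulr1 lerD//.
rewrite Rintegral_continuousD//; last exact: within_continuousM.
rewrite Rintegral_cst_itv// mul1r lerD2l Rintegral_continuousZ// ler_pM2l//.
rewrite (le_trans (sum_le _ _ (leqnn N)))// mulrA ler_pdivrMr//.
by rewrite mulrC ler_wpM2l// ler_nat.
Qed.

Lemma ae_avg_cos f C : 0 <= C ->
  (forall n, {within `[a, b], continuous (f n)}) ->
  (forall m n, (m < n)%N -> \int[mu]_(x in `[a, b]) cos (f n x - f m x) <= C / n.+1%:R)%R ->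
  {ae mu, forall x, a <= x <= b ->
    forall t, avg (fun n => cos (f n x + t)) N @[N --> \oo] --> 0}.
Proof.
move=> C0 cf fC.
(* Energy over [N^2] at [N = (j + 1)^2]: its integral is [O(1 / N)], which is summable in [j]. *)
pose h j x := (j.+1%:R ^- 2) ^+ 2 * energy (f ^~ x) (j.+1 ^ 2).
have cE k := @within_continuous_energy f k cf.
have h0 j x : 0 <= h j x by rewrite mulr_ge0 ?sqr_ge0 ?energy_ge0.
have ch j : {within `[a, b], continuous (h j)}.
  by apply: within_continuousM => //; exact: within_continuous_cst.
have hK j : (\int[mu]_(x in `[a, b]) h j x <= (b - a + 2 * C) / j.+1%:R ^+ 2)%R.
  rewrite Rintegral_continuousZ//.
  apply: (le_trans (ler_wpM2l _ (Rintegral_energy_le _ C0 cf fC))); first exact: sqr_ge0.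
  by rewrite natrX le_eqVlt; apply/orP; left; apply/eqP; field.
have := ae_cvg0_of_sum_Rintegral h0 ch hK.
apply: (@filterS _ _ (ae_filter_ringOfSetsType mu)) => x hx xab t.
apply: avg_cos_of_squares.
rewrite (_ : (fun j => _) = h ^~ x); first exact: hx.
by apply/funext => j; rewrite /h mulrC exprVn.
Qed.

End AlmostEverywhere.

(** * Koksma's theorem *)

Section Koksma.
Context {R : realType}.
Local Notation mu := (@lebesgue_measure R).

Lemma ae_forall_count (I : countType) (P : I -> R -> Prop) :
  (forall i, {ae mu, forall x, P i x}) -> {ae mu, forall x, forall i, P i x}.
Proof.
move=> aeP.
have := @ae_foralln _ _ _ mu (fun n x => if unpickle n is Some i then P i x else True).
move=> H; apply: (@filterS _ _ (ae_filter_ringOfSetsType mu) _ _ _ (H _)).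
  by move=> x Px i; have := Px (pickle i); rewrite pickleK.
move=> n; case: (unpickle n) => [i|]; first exact: aeP.
by apply: (@filterS _ _ (ae_filter_ringOfSetsType mu) _ _ _
  (@filterT _ _ (ae_filter_ringOfSetsType mu))).
Qed.

(** The derivatives are explicit arguments, so that the Leibniz rule gives those of a product and
    their signs are read off term by term. *)
Definition nonneg_C2 (G G1 G2 : R -> R) := forall x : R, 1 < x ->
  [/\ is_derive x 1 G (G1 x), is_derive x 1 G1 (G2 x), {for x, continuous G2}
    & [/\ 0 <= G x, 0 <= G1 x & 0 <= G2 x]].

Lemma is_derive_continuous (f : R -> R) (x df : R) : is_derive x 1 f df -> {for x, continuous f}.
Proof. by case=> /derivable1_diffP /differentiable_continuous. Qed.

Lemma nonneg_C2M G G1 G2 H H1 H2 : nonneg_C2 G G1 G2 -> nonneg_C2 H H1 H2 ->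
  nonneg_C2 (fun x => G x * H x) (fun x => G1 x * H x + G x * H1 x)
    (fun x => G2 x * H x + 2 * (G1 x * H1 x) + G x * H2 x).
Proof.
move=> hG hH x x1; have [dG dG1 cG2 [G0 G10 G20]] := hG x x1.
have [dH dH1 cH2 [H0 H10 H20]] := hH x x1.
have cG := is_derive_continuous dG; have cG1 := is_derive_continuous dG1.
have cH := is_derive_continuous dH; have cH1 := is_derive_continuous dH1.
split.
- by apply: is_derive_eq; rewrite /GRing.scale/=; ring.
- by apply: is_derive_eq; rewrite /GRing.scale/=; ring.
- apply: cvgD; last exact: cvgM.
  apply: cvgD; first exact: cvgM.
  by apply: cvgMr; exact: cvgM.
- by split; rewrite ?addr_ge0// ?mulr_ge0// mulr_ge0.
Qed.

Lemma nonneg_C2_cst (k : R) : 0 <= k -> nonneg_C2 (fun=> k) (fun=> 0) (fun=> 0).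
Proof.
move=> k0 x x1; split; [exact: is_derive_cst..|exact: cvg_cst|by split].
Qed.

Lemma is_derive_pow n (x : R) : is_derive x 1 (fun y : R => y ^+ n) (n%:R * x ^+ n.-1).
Proof.
have : is_derive x 1 ((@id R) ^+ n) ((n%:R * x ^+ n.-1) *: 1) by exact: is_deriveX.
by rewrite /GRing.scale/= mulr1 exprfctE.
Qed.

(** Serves both the differencing factors ([q = 0]) and the differences of powers in the phases.
    Where [.-1] truncates at 0, a zero coefficient makes the formula correct. *)
Lemma nonneg_C2_powB q p : (q <= p)%N -> nonneg_C2 (fun x => x ^+ p - x ^+ q)
  (fun x => p%:R * x ^+ p.-1 - q%:R * x ^+ q.-1)
  (fun x => p%:R * (p.-1%:R * x ^+ p.-1.-1) - q%:R * (q.-1%:R * x ^+ q.-1.-1)).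
Proof.
move=> qp x x1.
have dX := @is_derive_pow.
have mono m n : (m <= n)%N -> x ^+ m <= x ^+ n by move=> mn; rewrite ler_weXn2l// ltW.
have x0 : 0 <= x by rewrite ltW// (lt_trans _ x1).
have predle m n : (m <= n)%N -> (m.-1 <= n.-1)%N by lia.
split.
- by have ? := dX p x; have ? := dX q x; apply: is_derive_eq.
- have ? := dX p.-1 x; have ? := dX q.-1 x; apply: is_derive_eq.
  by rewrite /GRing.scale/=.
- have cX n : {for x, continuous (fun x : R => x ^+ n)} by exact: is_derive_continuous (dX n x).
  by apply: cvgB; do 2 apply: cvgMr; exact: cX.
- split; rewrite subr_ge0; first exact: mono.
    by rewrite ler_pM ?exprn_ge0// ?ler_nat// mono// predle.
  rewrite ler_pM ?mulr_ge0 ?exprn_ge0// ?ler_nat//.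
  by rewrite ler_pM ?exprn_ge0// ?ler_nat ?predle// mono// !predle.
Qed.

Lemma ae_koksma_itv (G G1 G2 : R -> R) (a b : R) : 1 < a -> a < b ->
  nonneg_C2 G G1 G2 -> (forall x, 1 < x -> 0 < G x) ->
  {ae mu, forall x, a <= x <= b ->
    forall t, avg (fun n => cos (x ^+ n.+1 * G x + t)) N @[N --> \oo] --> 0}.
Proof.
move=> a1 ab hG Gpos.
have gt1 x : a <= x <= b -> 1 < x by move=> /andP[ax _]; exact: lt_le_trans ax.
have contI (h h' : R -> R) : (forall x : R, 1 < x -> is_derive x 1 h (h' x)) ->
    {within `[a, b], continuous h}.
  move=> dh; apply: derivable_within_continuous => x; rewrite in_itv/= => xab.
  by case: (dh x (gt1 _ xab)).
have cG : {within `[a, b], continuous G} by apply: (contI _ G1) => x /hG[].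
(* The derivative of a phase difference will be at least [(a - 1) (n + 1)] times the minimum [G c]
   of [G] on the segment. *)
have [c cab minG] := EVT_min (ltW ab) cG.
have g0 : 0 < G c by apply/Gpos/gt1; rewrite in_itv/= in cab.
have a10 : 0 < a - 1 by rewrite subr_gt0.
apply: (@ae_avg_cos R a b ab (fun n x => x ^+ n.+1 * G x) (2 / ((a - 1) * G c))).
- by rewrite divr_ge0// mulr_ge0 ?ltW.
- move=> n; apply: within_continuousM => //.
  apply: (contI _ (fun x => n.+1%:R * x ^+ n)) => x _.
  exact: is_derive_pow.
move=> m n mn.
have hU := @nonneg_C2_powB m.+1 n.+1 (ltnW mn).
have hP := nonneg_C2M hU hG.
under eq_Rintegral do rewrite -mulrBl.
rewrite (_ : _ / n.+1%:R = 2 / ((a - 1) * G c * n.+1%:R)); last first.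
  by rewrite [in RHS]invfM [in RHS]mulrA.
apply: (@Rintegral_cos_le _ _ _ ab _
  (fun x => (n.+1%:R * x ^+ n - m.+1%:R * x ^+ m) * G x + (x ^+ n.+1 - x ^+ m.+1) * G1 x)
  (fun x => (n.+1%:R * (n%:R * x ^+ n.-1) - m.+1%:R * (m%:R * x ^+ m.-1)) * G x +
    2 * ((n.+1%:R * x ^+ n - m.+1%:R * x ^+ m) * G1 x) + (x ^+ n.+1 - x ^+ m.+1) * G2 x)) => //.
- by rewrite !mulr_gt0.
- by move=> x /gt1 /hP[].
- by move=> x /gt1 /hP[].
- apply: continuous_in_subspaceT => x; rewrite inE/= in_itv/= => xab; by case: (hP x (gt1 _ xab)).
- move=> x xab; have x1 := gt1 _ xab.
  have [_ _ _ [G0 G10 _]] := hG _ x1; have [_ _ _ [U0 _ _]] := hU _ x1.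
  apply: (@le_trans _ _ ((n.+1%:R * x ^+ n - m.+1%:R * x ^+ m) * G x)); last first.
    by rewrite lerDl mulr_ge0.
  rewrite mulrAC ler_pM//.
  + by rewrite mulr_ge0 ?ltW.
  + by rewrite ltW.
  + have xm : 1 <= x ^+ m by rewrite exprn_ege1// ltW.
    have xnm : x ^+ m.+1 <= x ^+ n by rewrite ler_weXn2l// ltW.
    have mn' : m.+1%:R <= n.+1%:R :> R by rewrite ler_nat ltnS ltnW.
    (* As [m < n], lower [x ^+ n] to [x ^+ m.+1] and raise [m.+1] to [n.+1]; then
       [x ^+ m.+1 - x ^+ m >= a - 1]. *)
    apply: (@le_trans _ _ (n.+1%:R * (x ^+ m.+1 - x ^+ m))).
      rewrite mulrC ler_wpM2l// exprS.
      have : a <= x by case/andP: xab.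
      by move: xm; nra.
    rewrite mulrBr lerB ?ler_wpM2l// ler_wpM2r// exprn_ge0// ltW// (lt_trans _ x1)//.
  + by apply: minG; rewrite in_itv.
- by move=> x /gt1 /hP[_ _ _ []].
Qed.

(** The gap is [(b - 1) b^n], and Bernoulli's inequality makes [b^n] at least [n + 1] times the
    smaller of [1] and [b - 1]. *)
Lemma pow_gap (b : R) : 1 < b ->
  exists2 k, 0 < k & forall n, k * n.+1%:R <= b ^+ n.+1 - b ^+ n.
Proof.
move=> b1; have b0 : 0 < b - 1 by rewrite subr_gt0.
have bern n : 1 + n%:R * (b - 1) <= b ^+ n.
  elim: n => [|n ih]; first by rewrite mul0r addr0.
  rewrite exprS (@le_trans _ _ (b * (1 + n%:R * (b - 1))))//; last first.
    by rewrite ler_pM2l// (lt_trans _ b1).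
  rewrite -subr_ge0 -natr1 (_ : _ - _ = n%:R * (b - 1) ^+ 2); last by ring.
  by rewrite mulr_ge0// sqr_ge0.
have gapE n : b ^+ n.+1 - b ^+ n = (b - 1) * b ^+ n by rewrite exprS; ring.
have [b2|b2] := leP b 2.
  exists ((b - 1) ^+ 2); first by rewrite exprn_gt0.
  move=> n; rewrite gapE expr2 -mulrA ler_pM2l// (le_trans _ (bern n))//.
  by rewrite -natr1; lra.
exists (b - 1) => // n; rewrite gapE ler_pM2l// (le_trans _ (bern n))//.
by rewrite -natr1; have := ler0n R n; nra.
Qed.

(** Phase differences are linear in [x]; by [pow_gap] their slope is at least [D k (n + 1)]. *)
Lemma ae_koksma_linear_itv (b D M : R) : 1 < b -> 0 < D -> 0 < M ->
  {ae mu, forall x, - M <= x <= M ->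
    forall t, avg (fun n => cos (x * (D * b ^+ n.+1) + t)) N @[N --> \oo] --> 0}.
Proof.
move=> b1 D0 M0; have [k k0 hk] := pow_gap b1.
have MM : - M < M by rewrite gtrN.
apply: (@ae_avg_cos R _ _ MM (fun n x => x * (D * b ^+ n.+1)) (2 / (D * k))).
- by rewrite divr_ge0// mulr_ge0 ?ltW.
- move=> n; apply: within_continuousM; last exact: within_continuous_cst.
  by apply: continuous_subspaceT => x; exact: cvg_id.
move=> m n mn.
under eq_Rintegral do rewrite -mulrBr.
rewrite (_ : _ / n.+1%:R = 2 / (D * k * n.+1%:R)); last first.
  by rewrite [in RHS]invfM [in RHS]mulrA.
apply: (@Rintegral_cos_le _ _ _ MM _ (fun=> D * b ^+ n.+1 - D * b ^+ m.+1) (fun=> 0)) => //.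
- by rewrite !mulr_gt0.
- by move=> x _; apply: is_derive_eq; rewrite /GRing.scale/= mulr0 add0r mulr1.
- exact: within_continuous_cst.
- move=> x _; rewrite -mulrA -mulrBr ler_pM2l//.
  rewrite (le_trans (hk n))// lerB// ler_weXn2l// ltW//.
Qed.

(** The derivative test wants positive slopes; evenness of the cosine restores a negative sign of
    [s], at the price of negating the phase. *)
Lemma avg_cos_norm (s : R) (y : nat -> R) :
  (forall t, avg (fun n => cos (`|s| * y n + t)) N @[N --> \oo] --> 0) ->
  forall t, avg (fun n => cos (s * y n + t)) N @[N --> \oo] --> 0.
Proof.
move=> hy t; have [s0|s0] := leP 0 s; first by move: (hy t); rewrite ger0_norm.
have := hy (- t); rewrite ltr0_norm//.
rewrite (@eq_avg _ _ (fun n => cos (s * y n + t)))// => n.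
by rewrite -cosN; congr cos; ring.
Qed.

Lemma unif_distributed_of_avg_cos (c b : R) :
  (forall (k : nat) (ks : seq nat) t, avg (fun n =>
     cos (2 * pi * k.+1%:R * c * b * b ^+ n * \prod_(l <- ks) (b ^+ l.+1 - 1) + t)) N
     @[N --> \oo] --> 0) ->
  forall Q : {poly R}, unif_distributed_mod1 (fun n => c * b ^+ n + Q.[n%:R]).
Proof.
move=> H Q; apply: weyl_criterion => -[//|k] t _.
(* Indices start at 1: the shift turns [b ^+ n] into [b * b ^+ n] and translates [Q]. The phase [t]
   joins the polynomial. *)
pose Q' := (2 * pi * k.+1%:R)%:P * (Q \Po ('X + 1%:P)) + t%:P.
have := avg_cos_addpoly (H k) Q'.
rewrite (@eq_avg _ _ (fun i => cos (2 * pi * k.+1%:R * (c * b ^+ i.+1 + Q.[i.+1%:R]) + t)))//.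
move=> n; congr cos; rewrite /Q' hornerD hornerM !hornerC horner_comp hornerD hornerX hornerC.
by rewrite natr1 exprS; ring.
Qed.

End Koksma.

(** * Application to [g] and choice of the null sets *)

Lemma nonneg_C2_of_Cplus (R : realType) (g : R -> R) : Cplus 2 `]1, +oo[ g ->
  nonneg_C2 g (derive1 g) (derive1n 2 g).
Proof.
move=> [gpos dg cg g0] x x1.
have Ix : `]1, +oo[%classic x by rewrite /= in_itv/= x1.
have d0 := dg 0%N isT x Ix; have d1 := dg 1%N isT x Ix.
split.
- by rewrite derive1E; exact: derivableP.
- by rewrite /= derive1E; exact: derivableP.
(* Openness of the half-line turns continuity within it into continuity at [x]. *)
- have := cg 2%N isT; rewrite continuous_open_subspace; last exact: interval_open.
  by apply; rewrite inE.
- by split; [exact: (g0 0%N)|exact: (g0 1%N)|exact: (g0 2%N)].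
Qed.

Lemma nonneg_C2_prod (R : realType) (ks : seq nat) : exists P1 P2 : R -> R,
  nonneg_C2 (fun x => \prod_(l <- ks) (x ^+ l.+1 - 1)) P1 P2.
Proof.
elim: ks => [|l ks [P1 [P2 hP]]].
  exists (fun=> 0), (fun=> 0).
  rewrite (_ : (fun x => _) = fun=> 1); first exact: nonneg_C2_cst.
  by apply/funext => x; rewrite big_nil.
have := nonneg_C2M (@nonneg_C2_powB R 0 l.+1 isT) hP.
rewrite (_ : (fun x => _ * _) = (fun x => \prod_(l <- l :: ks) (x ^+ l.+1 - 1))).
  by move=> h; eexists; eexists; exact: h.
by apply/funext => x; rewrite big_cons expr0.
Qed.

Lemma prod_pow_gt0 (R : realType) (x : R) (ks : seq nat) : 1 < x ->
  0 < \prod_(l <- ks) (x ^+ l.+1 - 1).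
Proof. by move=> x1; apply: prodr_gt0 => l _; rewrite subr_gt0 exprn_egt1. Qed.

(** A countable cover by segments of positive length: the left ends are at most 2, the right ends at
    least 3. *)
Lemma gt1_itv_cover (R : realType) (x : R) : 1 < x ->
  exists M : nat, 1 + M.+1%:R^-1 <= x <= M.+3%:R.
Proof.
move=> x1; have x10 : 0 < x - 1 by rewrite subr_gt0.
exists (maxn (Num.truncn (x - 1)^-1) (Num.truncn x)); set M := maxn _ _; apply/andP; split.
  rewrite -lerBrDl -[leRHS]invrK lef_pV2 ?posrE ?invr_gt0//.
  by rewrite (le_trans (ltW (truncnS_gt _)))// ler_nat ltnS leq_maxl.
rewrite (le_trans (ltW (truncnS_gt _)))// ler_nat ltnS.
by rewrite (leq_trans (leq_maxr (Num.truncn (x - 1)^-1) _))// -/M; lia.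
Qed.

Theorem theorem1 (R : realType) (g : R -> R) (hg : Cplus 2 `]1, +oo[ g) :
  (forall alpha : R, alpha != 0 ->
     {ae (@lebesgue_measure R), forall beta : R, 1 < beta ->
        forall Q : {poly R},
          unif_distributed_mod1
            (fun n : nat => alpha * beta ^+ n * g beta + Q.[n%:R])})
  /\
  (forall beta : R, 1 < beta ->
     {ae (@lebesgue_measure R), forall alpha : R,
        forall Q : {poly R},
          unif_distributed_mod1
            (fun n : nat => alpha * beta ^+ n * g beta + Q.[n%:R])}).
Proof.
have p0 := @pi_gt0 R.
have gpos (x : R) : 1 < x -> 0 < g x.
  by move=> x1; case: hg => + _ _ _; apply; rewrite /= in_itv/= x1.
have udE (a b : R) (Q : {poly R}) : (fun n : nat => a * b ^+ n * g b + Q.[n%:R]) =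
    (fun n => (a * g b) * b ^+ n + Q.[n%:R]).
  by apply/funext => n; rewrite mulrAC.
split=> [alpha alpha0|b b1].
  pose G (i : nat * seq nat) x := 2 * pi * i.1.+1%:R * `|alpha| *
    (\prod_(l <- i.2) (x ^+ l.+1 - 1) * g x).
  have c0 (k : nat) : 0 < 2 * pi * k.+1%:R * `|alpha| by rewrite !mulr_gt0// normr_gt0.
  (* One null set for all frequencies, lag lists and segments, a countable family in which [Q] does
     not occur. *)
  have aeG : {ae lebesgue_measure, forall x : R, forall j : (nat * seq nat) * nat,
      1 + j.2.+1%:R^-1 <= x <= j.2.+3%:R ->
      forall t, avg (fun n => cos (x ^+ n.+1 * G j.1 x + t)) N @[N --> \oo] --> 0}.
    apply: ae_forall_count => -[[k ks] M] /=.
    have [P1 [P2 hP]] := @nonneg_C2_prod R ks.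
    have hG := nonneg_C2M (nonneg_C2_cst (ltW (c0 k))) (nonneg_C2M hP (nonneg_C2_of_Cplus hg)).
    apply: (ae_koksma_itv _ _ hG).
    - by rewrite ltrDl invr_gt0.
    - rewrite (@le_lt_trans _ _ 2) ?ltr_nat//.
      by rewrite -[leRHS]/(1 + 1) lerD2l invf_le1// ler1n.
    - by move=> x x1; rewrite mulr_gt0 ?c0// mulr_gt0 ?gpos// prod_pow_gt0.
  apply: (@filterS _ _ (ae_filter_ringOfSetsType _) _ _ _ aeG) => x hx x1 Q.
  rewrite udE; apply: unif_distributed_of_avg_cos => k ks t.
  have [M xM] := gt1_itv_cover x1.
  pose y n := x ^+ n.+1 * (2 * pi * k.+1%:R * (\prod_(l <- ks) (x ^+ l.+1 - 1) * g x)).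
  rewrite (@eq_avg _ _ (fun n => cos (alpha * y n + t))); last first.
    by move=> n; congr (cos (_ + t)); rewrite /y exprS; ring.
  (* Passes from [alpha] to the absolute value used in [G] for positivity. *)
  apply: avg_cos_norm => u; have := hx (k, ks, M) xM u.
  rewrite (@eq_avg _ _ (fun n => cos (`|alpha| * y n + u)))// => n.
  by congr (cos (_ + u)); rewrite /G /y/=; ring.
pose D (i : nat * seq nat) := 2 * pi * i.1.+1%:R * (\prod_(l <- i.2) (b ^+ l.+1 - 1) * g b).
have aeD : {ae lebesgue_measure, forall x : R, forall j : (nat * seq nat) * nat,
    - j.2.+1%:R <= x <= j.2.+1%:R ->
    forall t, avg (fun n => cos (x * (D j.1 * b ^+ n.+1) + t)) N @[N --> \oo] --> 0}.
  apply: ae_forall_count => -[[k ks] M] /=.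
  apply: ae_koksma_linear_itv => //; rewrite /D/= !mulr_gt0 ?gpos//.
  exact: prod_pow_gt0.
apply: (@filterS _ _ (ae_filter_ringOfSetsType _) _ _ _ aeD) => x hx Q.
rewrite udE; apply: unif_distributed_of_avg_cos => k ks t.
(* The symmetric segments exhaust the line, so [alpha] of either sign is covered. *)
have xM : - (Num.truncn `|x|).+1%:R <= x <= (Num.truncn `|x|).+1%:R.
  by rewrite -ler_norml ltW// truncnS_gt.
have := hx (k, ks, Num.truncn `|x|) xM t.
rewrite (@eq_avg _ _ (fun n => cos (2 * pi * k.+1%:R * (x * g b) * b * b ^+ n *
  \prod_(l <- ks) (b ^+ l.+1 - 1) + t)))// => n.
by congr (cos (_ + t)); rewrite /D/= exprS; ring.
Qed.
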